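(* Let $q$ be a power of a prime $p$, and let $n\in\mathbb{N}$ satisfy $n\mid q+1$. Let $\alpha$ be a generator of the multiplicative group $\mathbb{F}_{q^2}^\times$ and set $\omega=\alpha^{(q^2-1)/n}$. Given $D\subseteq\mathbb{Z}/n\mathbb{Z}$, the $|D|\times n$ matrix $\mathcal{F}_D=[\omega^{ij}]_{i\in D,\,j\in\mathbb{Z}/n\mathbb{Z}}$ over $\mathbb{F}_{q^2}$ is an ETF (i.e., its columns form an $(a,b,c)$-ETF in the complex model on $\mathbb{F}_{q^2}^{|D|}$ for some $a,b,c\in\mathbb{F}_q$) if and only if $D$ is a $p$-modular difference set.
   Context: Complex model: $\mathbb{F}_{q^2}^d$ (column vectors) with the Hermitian form $(x,y)=\sum_{i=1}^d x_i^q y_i$. For a matrix $A=[a_{ij}]$ over $\mathbb{F}_{q^2}$, $A^*=[a_{ji}^q]$. A $d\times n$ matrix $\Phi$ with columns $\varphi_1,\dots,\varphi_n\in\mathbb{F}_{q^2}^d$ is an $(a,b,c)$-ETF ($a,b,c\in\mathbb{F}_q$) in the complex model if $(\varphi_j,\varphi_j)=a$ for all $j$, $(\varphi_i,\varphi_j)(\varphi_j,\varphi_i)=b$ for all $i\neq j$, the columns span $\mathbb{F}_{q^2}^d$, and $\Phi\Phi^*=cI$. For $k,n\in\mathbb{N}$, a set $D\subseteq\mathbb{Z}/n\mathbb{Z}$ is a $k$-modular difference set if the function $c\colon\mathbb{Z}/n\mathbb{Z}\to\mathbb{Z}/k\mathbb{Z}$, $c(g)=|\{(a,b)\in D^2:a-b=g\}|\bmod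 k$, is constant on $(\mathbb{Z}/n\mathbb{Z})\setminus\{0\}$. *)

(* Defs.v *)
From HB Require Import structures.
From mathcomp Require Import all_boot all_order all_algebra.
From mathcomp Require Import all_fingroup all_solvable all_field.

Set Implicit Arguments.
Unset Strict Implicit.
Unset Printing Implicit Defensive.

Import GRing.Theory.
Local Open Scope ring_scope.

Definition hform (F : fieldType) (q d : nat) (x y : 'cV[F]_d) : F :=
  \sum_(i < d) x i ord0 ^+ q * y i ord0.

Definition conjtr (F : fieldType) (q d n : nat) (A : 'M[F]_(d, n)) :
  'M[F]_(n, d) := \matrix_(i, j) A j i ^+ q.

(* The inclusion of F_q in F_{q^2} is an explicit field embedding [iota], so   *)
(* the parameters a, b, c are genuinely elements of F_q.                      *)
Record is_ETF (Fq Fq2 : fieldType) (iota : {rmorphism Fq -> Fq2})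
    (q d n : nat) (a b c : Fq) (Phi : 'M[Fq2]_(d, n)) : Prop := IsETF {
  ETF_norm : forall j : 'I_n, hform q (col j Phi) (col j Phi) = iota a;
  ETF_angle : forall i j : 'I_n, i != j ->
    hform q (col i Phi) (col j Phi) * hform q (col j Phi) (col i Phi) = iota b;
  ETF_span : <<[seq col j Phi | j : 'I_n]>>%VS = fullv;
  ETF_tight : Phi *m conjtr q Phi = (iota c)%:M
}.

Definition diff_count (G : finZmodType) (D : {set G}) (g : G) : nat :=
  #|[set ab in setX D D | ab.1 - ab.2 == g]|.

(* Equality in Z/kZ is congruence of natural numbers modulo k.                *)
Definition modular_difference_set (k : nat) (G : finZmodType) (D : {set G}) :
  Prop :=
  forall g h : G, g != 0 -> h != 0 ->
    (diff_count D g = diff_count D h %[mod k])%N.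

(* 'I_n.+1 carries the additive group structure of Z/(n+1)Z; it is used       *)
(* rather than 'Z_n, which does not denote the trivial group for n = 1. Rows   *)
(* are indexed by D through its enumeration, and the exponent is the product  *)
(* of the representatives in {0, ..., n} of the two residues.                 *)
Definition dft_submx (F : fieldType) (n : nat) (omega : F)
    (D : {set 'I_n.+1}) : 'M[F]_(#|D|, n.+1) :=
  \matrix_(i < #|D|, j < n.+1) omega ^+ (enum_val i * j)%N.

(* Main.v *)
(* The Gram matrix entry at (i, j) is S(j - i), where S(t) is the sum of       *)
(* omega^(kt) over k in D, because omega^q = omega^-1.  Hence the angle        *)
(* condition says that S(t) S(-t), which is the Fourier transform of the       *)
(* difference counts of D, is constant for t <> 0.  The Fourier transform      *)
(* preserves being constant off 0, and is its own inverse up to the reflection *)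
(* g -> -g and the factor n + 1, which is invertible because it divides q + 1; *)
(* so this means that the difference counts are constant off 0 modulo p.  The  *)
(* remaining ETF conditions hold for every D.                                  *)
Require Import Defs.
From HB Require Import structures.
From mathcomp Require Import all_boot all_order all_algebra.
From mathcomp Require Import all_fingroup all_solvable all_field.

Set Implicit Arguments.
Unset Strict Implicit.
Unset Printing Implicit Defensive.

Import GRing.Theory.
Local Open Scope ring_scope.

(** [hform_dft_submx] computes S, and [dft_diff_count] identifies S(t) S(-t) with the transform of
    the difference counts. [dft_const_off0] then turns constant counts into constant angles; applied
    to the transform itself and combined with the inversion [dftK], it gives the converse. Tightness
    is orthogonality of characters, and spanning follows from tightness. *)

Section Character.

Variables (F : fieldType) (n : nat) (w : F).
Hypothesis w_prim : n.+1.-primitive_root w.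
Implicit Types (i j k t g : 'I_n.+1) (f : 'I_n.+1 -> F) (D : {set 'I_n.+1}).

Definition zchar i j : F := w ^+ (i * j)%N.

Lemma zcharC i j : zchar i j = zchar j i.
Proof. by rewrite /zchar mulnC. Qed.

Lemma zchar0 j : zchar 0 j = 1.
Proof. by rewrite /zchar mul0n expr0. Qed.

(** Addition in ['I_n.+1] reduces modulo n + 1, which is harmless since [w] has order n + 1. *)
Lemma zcharD i k j : zchar (i + k) j = zchar i j * zchar k j.
Proof.
rewrite /zchar -exprD -mulnDl -[LHS](prim_expr_mod w_prim).
by rewrite /= modnMml (prim_expr_mod w_prim).
Qed.

Lemma zcharN i j : zchar (- i) j = (zchar i j)^-1.
Proof.
have h : zchar (- i) j * zchar i j = 1 by rewrite -zcharD addNr zchar0.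
have nz : zchar i j != 0.
  by apply: contra_eq_neq h => ->; rewrite mulr0 eq_sym oner_neq0.
by apply: (mulIf nz); rewrite h mulVf.
Qed.

Lemma zcharNr i j : zchar i (- j) = (zchar i j)^-1.
Proof. by rewrite zcharC zcharN zcharC. Qed.

Lemma zcharDr i j k : zchar i (j + k) = zchar i j * zchar i k.
Proof. by rewrite zcharC zcharD !(zcharC i). Qed.

(** Character values are (n + 1)-th roots of unity, so their (q + 1)-th powers are 1. *)
Lemma zcharX q i j : (n.+1 %| q + 1)%N -> zchar i j ^+ q = (zchar i j)^-1.
Proof.
move=> hq; have h : zchar i j ^+ q * zchar i j = 1.
  rewrite -exprSr -addn1 /zchar -exprM mulnC exprM.
  by move: hq; rewrite (prim_order_dvd w_prim) => /eqP ->; rewrite expr1n.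
have nz : zchar i j != 0.
  by apply: contra_eq_neq h => ->; rewrite mulr0 eq_sym oner_neq0.
by apply: (mulIf nz); rewrite h mulVf.
Qed.

(** For nonzero [i] this is a geometric sum: multiplied by [w ^+ i - 1], it telescopes to 0. *)
Lemma sum_zchar i : \sum_j zchar i j = if i == 0 then n.+1%:R else 0.
Proof.
case: eqVneq => [->|i_neq0].
  under eq_bigr do rewrite zchar0.
  by rewrite sumr_const card_ord.
have wi_neq1 : w ^+ i - 1 != 0.
  rewrite subr_eq0 -(prim_order_dvd w_prim) gtnNdvd //.
  by rewrite lt0n; apply: contra_neq i_neq0 => i0; apply: val_inj.
apply: (mulfI wi_neq1); rewrite mulr0.
under eq_bigr do rewrite /zchar exprM.
by rewrite -subrX1 exprAC (prim_expr_order w_prim) expr1n subrr.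
Qed.

Definition dft f t : F := \sum_g f g * zchar g t.

(** Such an [f] is the constant [b] plus a multiple of the delta function at 0. The first part has
    transform 0 off 0, the second a constant transform. *)
Lemma dft_const_off0 f (b : F) t :
  (forall g, g != 0 -> f g = b) -> t != 0 -> dft f t = f 0 - b.
Proof.
move=> fb t_neq0.
have sum_b : \sum_g b * zchar g t = 0.
  rewrite -mulr_sumr; under eq_bigr do rewrite zcharC.
  by rewrite sum_zchar (negPf t_neq0) mulr0.
have -> : dft f t = \sum_g b * zchar g t + \sum_g (f g - b) * zchar g t.
  by rewrite -big_split; apply: eq_bigr => g _ /=; rewrite -mulrDl subrKC.
rewrite sum_b add0r (bigD1 (0 : 'I_n.+1)) //= zchar0 mulr1 big1 ?addr0 //.
by move=> g /fb ->; rewrite subrr mul0r.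
Qed.

Lemma dftK f t : dft (dft f) t = n.+1%:R * f (- t).
Proof.
rewrite /dft; under eq_bigr do rewrite mulr_suml.
have inner g : \sum_u f g * zchar g u * zchar u t =
    f g * if g == - t then n.+1%:R else 0.
  rewrite -addr_eq0 -sum_zchar mulr_sumr; apply: eq_bigr => u _.
  by rewrite -mulrA (zcharC u) zcharD.
rewrite exchange_big /=; under eq_bigr do rewrite inner.
rewrite (bigD1 (- t)) //= eqxx big1 ?addr0 1?mulrC // => g /negPf ->.
by rewrite mulr0.
Qed.

(** The difference counts are the autocorrelation of the indicator of [D]: expand the product over
    pairs and group them by difference. *)
Lemma dft_diff_count D t :
  dft (fun g => (diff_count D g)%:R) t =
  (\sum_(k in D) zchar k t) * (\sum_(k in D) zchar k (- t)).
Proof.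
rewrite big_distrlr pair_big /=.
rewrite (partition_big (fun ab => ab.1 - ab.2) predT) //=.
apply: eq_bigr => g _; rewrite mulr_natl -sumr_const; apply: eq_big => [ab|ab].
  by rewrite !inE.
by rewrite !inE => /andP[_ /eqP <-]; rewrite zcharNr zcharD zcharN.
Qed.

Lemma hform_dft_submx q D i j : (n.+1 %| q + 1)%N ->
  hform q (col i (dft_submx w D)) (col j (dft_submx w D)) =
  \sum_(k in D) zchar k (j - i).
Proof.
move=> hq; rewrite big_enum_val; apply: eq_bigr => k _.
by rewrite !mxE -!/(zchar _ _) zcharX // zcharDr zcharNr mulrC.
Qed.

Lemma dft_submx_tight q D : (n.+1 %| q + 1)%N ->
  dft_submx w D *m conjtr q (dft_submx w D) = n.+1%:R%:M.
Proof.
move=> hq; apply/matrixP => k l; rewrite !mxE.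
transitivity (\sum_j zchar (enum_val k - enum_val l) j).
  apply: eq_bigr => j _.
  by rewrite !mxE -!/(zchar _ _) zcharX // zcharD zcharN.
by rewrite sum_zchar subr_eq0 (inj_eq enum_val_inj); case: eqP.
Qed.

End Character.

Lemma generator_prim_root (F : finFieldType) (x : {unit F}) :
  generator [set: {unit F}] x -> #|F|.-1.-primitive_root (val x).
Proof.
move=> /eqP gen_x.
have ox : #[x]%g = #|F|.-1 by rewrite /order -gen_x card_finField_unit.
rewrite -ox /primitive_root_of_unity order_gt0; apply/forallP => i.
rewrite unity_rootE -FinRing.val_unitX -FinRing.val_unit1 val_eqE -order_dvdn.
apply/eqP; apply/idP/eqP => [/dvdn_leq le_o|->]; last exact: dvdnn.
by apply/eqP; rewrite eqn_leq ltn_ord le_o.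
Qed.

(** Each x equals A(Bx), a combination of the columns of A. *)
Lemma right_invertible_span (F : fieldType) d n (A : 'M[F]_(d, n))
    (B : 'M[F]_(n, d)) :
  A *m B = 1%:M -> <<[seq col j A | j : 'I_n]>>%VS = fullv.
Proof.
move=> AB1; apply/vspaceP => x; rewrite memvf.
have -> : x = \sum_j (B *m x) j 0 *: col j A.
  rewrite -[LHS]mul1mx -AB1 -mulmxA; apply/colP => i.
  by rewrite !mxE summxE; apply: eq_bigr => j _; rewrite !mxE mulrC.
apply: memv_suml => j _; apply: memvZ; apply: memv_span.
exact: image_f.
Qed.

Lemma eq_natr_pchar (R : nzRingType) (p a b : nat) : p \in [pchar R] ->
  (a%:R == b%:R :> R) = (a == b %[mod p])%N.
Proof.
move=> pR; wlog le_ba : a b / (b <= a)%N => [ih|].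
  case/orP: (leq_total b a) => [/ih//|/ih]; rewrite eq_sym => ->.
  by rewrite eq_sym.
by rewrite -subr_eq0 -natrB // -(dvdn_pcharf pR) eqn_mod_dvd.
Qed.

Theorem theorem5p7 (p m q n : nat) (Fq Fq2 : finFieldType)
  (iota : {rmorphism Fq -> Fq2}) (alpha : {unit Fq2}) (D : {set 'I_n.+1})
  (hp : prime p) (hm : (0 < m)%N) (hq : q = (p ^ m)%N)
  (hFq : #|Fq| = q) (hFq2 : #|Fq2| = (q ^ 2)%N)
  (hn : (n.+1 %| q + 1)%N)
  (halpha : generator [set: {unit Fq2}] alpha) :
  let omega : Fq2 := val alpha ^+ ((q ^ 2 - 1) %/ n.+1)%N in
  (exists a b c : Fq, is_ETF iota q a b c (dft_submx omega D))
  <-> modular_difference_set p D.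
Proof.
move=> omega.
have w_prim : n.+1.-primitive_root omega.
  (* [alpha] has order q^2 - 1 = (q - 1)(q + 1), a multiple of n + 1. *)
  apply: dvdn_prim_root; last by rewrite -(exp1n 2) subn_sqr dvdn_mull.
  by rewrite subn1 -hFq2; exact: generator_prim_root.
have pF : p \in [pchar Fq2].
  by apply: (@card_finPcharP _ _ (m * 2)); rewrite // hFq2 hq expnM.
(* If p divided n + 1, it would divide q + 1 as well as q, hence 1. *)
have N_neq0 : n.+1%:R != 0 :> Fq2.
  rewrite -(dvdn_pcharf pF); apply/negP => /dvdn_trans /(_ hn).
  by rewrite dvdn_addr ?Euclid_dvd1 // hq dvdn_exp.
pose cnt g : Fq2 := (diff_count D g)%:R.
have gramE i j :
    hform q (col i (dft_submx omega D)) (col j (dft_submx omega D)) *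
    hform q (col j (dft_submx omega D)) (col i (dft_submx omega D)) =
    dft omega cnt (j - i).
  by rewrite !hform_dft_submx // dft_diff_count // opprB.
split=> [[a [b [c [_ angle _ _]]]] g h g_neq0 h_neq0|mds].
- have dftb t : t != 0 -> dft omega cnt t = iota b.
    by move=> t_neq0; rewrite -(angle 0 t) 1?eq_sym // gramE subr0.
  (* Transforming twice recovers (n + 1) [cnt g'], and the transform of a function equal to [iota b]
     off 0 is constant off 0. *)
  have NcntE g' : g' != 0 ->
      n.+1%:R * cnt g' = dft omega cnt 0 - iota b.
    move=> g'_neq0; rewrite -[g' in LHS]opprK -(dftK w_prim).
    by rewrite (dft_const_off0 w_prim dftb) // oppr_eq0.
  apply/eqP; rewrite -(eq_natr_pchar _ _ pF); apply/eqP.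
  by apply: (mulfI N_neq0); rewrite -/(cnt g) -/(cnt h) !NcntE.
have [l cntl] : exists l, forall g, g != 0 -> diff_count D g = l %[mod p].
  have [g g_neq0|all0] := pickP (fun g : 'I_n.+1 => g != 0).
    by exists (diff_count D g) => h h_neq0; exact: mds.
  (* Here the group is trivial, so any value of [l] would do. *)
  by exists 0%N => g; rewrite all0.
(* These are S(0), the off-0 value given by [dft_const_off0], and the squared norm of a full
   character; as images of integers they already lie in [Fq]. *)
exists #|D|%:R, ((diff_count D 0)%:R - l%:R), n.+1%:R; split.
- move=> j; rewrite hform_dft_submx // subrr rmorph_nat.
  by under eq_bigr do rewrite zcharC zchar0; rewrite sumr_const.
- move=> i j i_neq_j; rewrite gramE rmorphB !rmorph_nat.
  apply: (dft_const_off0 w_prim); last by rewrite subr_eq0 eq_sym.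
  by move=> g /cntl/eqP; rewrite -(eq_natr_pchar _ _ pF) => /eqP.
- apply: (@right_invertible_span _ _ _ _
           (n.+1%:R^-1 *: conjtr q (dft_submx omega D))).
  by rewrite -scalemxAr dft_submx_tight // scale_scalar_mx mulVf.
by rewrite dft_submx_tight // (rmorph_nat iota).
Qed.
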